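(* Let $X,Y$ be discrete metric spaces of bounded geometry with property A, and suppose that $X\times Y$ is endowed with a metric that restricts to the metric on $X$ (respectively $Y$) on each fibre $X\times\{y\}$ (respectively $\{x\}\times Y$). Suppose also that $d((x,y),(x',y'))\ge\max\{d(x,x'),d(y,y')\}$ for all pairs $(x,y),(x',y')$ of elements of $X\times Y$. Then $X\times Y$ has property A.
   Context: A discrete metric space $X$ has bounded geometry if for all $r>0$ there exists $N_r$ such that $|B(x,r)|<N_r$ for all $x\in X$. A discrete metric space $(X,d)$ has property A if for all $R,\epsilon>0$ there exists a family $\{A_x\}_{x\in X}$ of finite, non-empty subsets of $X\times\mathbb{N}$ such that (i) for all $x,y\in X$ with $d(x,y)\le R$ we have $\frac{|A_x\triangle A_y|}{|A_x\cap A_y|}<\epsilon$; (ii) there exists $S$ such that for each $x\in X$, if $(y,n)\in A_x$ then $d(x,y)\le S$. *)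

(* Defs.v *)
From HB Require Import structures.
From mathcomp Require Import all_boot all_order all_algebra finmap.
From mathcomp Require Import all_classical all_reals all_analysis.

Set Implicit Arguments.
Unset Strict Implicit.
Unset Printing Implicit Defensive.

Import Order.TTheory GRing.Theory Num.Theory.

Local Open Scope classical_set_scope.
Local Open Scope ring_scope.

(* [metric_on R T] is the type of metric structures on the type [T], so that a
   product can carry a metric other than the library's canonical one on pairs.
   The topology of [endow m] is the one induced by its own distance. *)
Definition metric_on (R : realType) (T : Type) : Type := Metric.axioms_ R T.

Definition endow (R : realType) (T : Type) (m : metric_on R T) : metricType R :=
  Metric.Pack m.

Definition dist_of (R : realType) (T : Type) (m : metric_on R T) : T -> T -> R :=
  @mdist R (endow m).

Definition discrete_metric_space (R : realType) (X : metricType R) : Prop :=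
  forall x : X, open [set x].

(* Finiteness is stated separately because [fset_set] sends infinite sets to
   the empty set. *)
Definition bounded_geometry (R : realType) (X : metricType R) : Prop :=
  forall r : R, 0 < r ->
    exists N : nat, forall x : X,
      finite_set (ball x r) /\ (#|` fset_set (ball x r)| < N)%N.

(* The quotient in the second clause only makes sense for a nonempty
   intersection; division by zero returns zero here, so nonemptiness has to be
   required explicitly. *)
Definition property_A (R : realType) (X : metricType R) : Prop :=
  forall r eps : R, 0 < r -> 0 < eps ->
    exists A : X -> {fset X * nat},
      [/\ forall x : X, A x != fset0,
          forall x y : X, mdist x y <= r ->
            (A x `&` A y)%fset != fset0 /\
            #|` ((A x `\` A y) `|` (A y `\` A x))%fset|%:R
              / #|` (A x `&` A y)%fset|%:R < eps
        & exists S : R, forall (x y : X) (n : nat),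
            (y, n) \in A x -> mdist x y <= S].

(* Main.v *)
(* Given Property A families A for X and B for Y, the sets A_x * B_y, read
   inside (X * Y) * nat through a pairing of nat * nat with nat, witness
   Property A for X * Y.  Intersections multiply and unions are contained in
   the product of the unions, so |union| < (1 + e) |intersection| in both
   factors gives |union| < (1 + e)^2 |intersection| in the product. *)
Require Import Defs.
From HB Require Import structures.
From mathcomp Require Import all_boot all_order all_algebra finmap.
From mathcomp Require Import all_classical all_reals all_analysis.
From mathcomp Require Import lra.

Set Implicit Arguments.
Unset Strict Implicit.
Unset Printing Implicit Defensive.

Import Order.TTheory GRing.Theory Num.Theory.
Local Open Scope ring_scope.

Lemma card_fsetM (K L : choiceType) (A : {fset K}) (B : {fset L}) :
  #|` (A `*` B)%fset| = (#|` A| * #|` B|)%N.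
Proof.
rewrite /fsetM (perm_size (enum_imfset2 _ _)) ?size_allpairs//.
by move=> [x y] [x' y'] _ _ [-> ->].
Qed.

Lemma card_fset_symdiff (K : choiceType) (A B : {fset K}) :
  (#|` (A `\` B) `|` (B `\` A)|%fset + #|` A `&` B|%fset)%N =
  #|` A `|` B|%fset.
Proof.
rewrite -[RHS](cardfsID (A `&` B)%fset) addnC; congr (_ + _)%N.
  by congr (#|` _|); apply/fsetP => x; rewrite !inE; do 2!case: (x \in _).
by congr (#|` _|); apply/fsetP => x; rewrite !inE; do 2!case: (x \in _).
Qed.

(** The symmetric difference has [|union| - |intersection|] elements, so clearing the positive
    denominator leaves a bound on the union. Unions are easier to control in products than symmetric
    differences. *)
Lemma symdiff_ratio_lt (R : realFieldType) (K : choiceType) (A B : {fset K})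
    (e : R) : (A `&` B != fset0)%fset ->
  (#|` (A `\` B) `|` (B `\` A)|%fset%:R / #|` A `&` B|%fset%:R < e) =
  (#|` A `|` B|%fset%:R < (1 + e) * #|` A `&` B|%fset%:R).
Proof.
rewrite -cardfs_gt0 => I0.
rewrite ltr_pdivrMr ?ltr0n// -(card_fset_symdiff A B) natrD mulrDl mul1r.
by rewrite [in RHS]addrC ltrD2l.
Qed.

Section FsetProductImage.
Variables (K L M : choiceType) (f : K * L -> M).
Hypothesis f_inj : injective f.
Implicit Types (A : {fset K}) (B : {fset L}).

Lemma card_imfsetM A B : #|` f @` (A `*` B)|%fset = (#|` A| * #|` B|)%N.
Proof. by rewrite card_imfset// card_fsetM. Qed.

Lemma imfsetMI A A' B B' :
  (f @` (A `*` B) `&` f @` (A' `*` B') =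
   f @` ((A `&` A') `*` (B `&` B')))%fset.
Proof.
rewrite -imfsetI; last by move=> ? ? _ _; exact: f_inj.
have -> // : ((A `*` B) `&` (A' `*` B') = (A `&` A') `*` (B `&` B'))%fset.
by apply/fsetP => -[x y]; rewrite !inE/= andbACA.
Qed.

(** Only an inclusion: the right side also contains mixed pairs, with one coordinate in [A] and the
    other in [B']. It suffices, since the union is only bounded from above. *)
Lemma imfsetMU_sub A A' B B' :
  (f @` (A `*` B) `|` f @` (A' `*` B') `<=`
   f @` ((A `|` A') `*` (B `|` B')))%fset.
Proof.
rewrite -imfsetU; apply: subset_imfset => -[x y]; rewrite !inE/=.
by case/orP => /andP[-> ->]; rewrite ?orbT.
Qed.

Lemma symdiff_ratio_imfsetM (R : realFieldType) A A' B B' (e : R) :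
  (A `&` A' != fset0)%fset -> (B `&` B' != fset0)%fset ->
  #|` (A `\` A') `|` (A' `\` A)|%fset%:R / #|` A `&` A'|%fset%:R < e ->
  #|` (B `\` B') `|` (B' `\` B)|%fset%:R / #|` B `&` B'|%fset%:R < e ->
  let C := (f @` (A `*` B))%fset in let C' := (f @` (A' `*` B'))%fset in
  (C `&` C' != fset0)%fset /\
  #|` (C `\` C') `|` (C' `\` C)|%fset%:R / #|` C `&` C'|%fset%:R
    < e * (2 + e).
Proof.
move=> I0 J0; rewrite !symdiff_ratio_lt// => ltA ltB C C'.
have CI0 : (C `&` C' != fset0)%fset.
  by rewrite -cardfs_gt0 imfsetMI card_imfsetM muln_gt0 !cardfs_gt0 I0.
split=> //; rewrite symdiff_ratio_lt// imfsetMI card_imfsetM.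
apply: (@le_lt_trans _ _ (#|` A `|` A'|%fset * #|` B `|` B'|%fset)%:R).
  by rewrite ler_nat -card_imfsetM; exact/fsubset_leq_card/imfsetMU_sub.
(* The strict bounds multiply because cardinals are nonnegative; the new ratio bound is
   [(1 + e)^2 - 1 = e * (2 + e)]. *)
rewrite !natrM; apply: (lt_le_trans (ltr_pM _ _ ltA ltB)) => //.
by lra.
Qed.

End FsetProductImage.

(** An isolating radius speaks of distances only, so it can be compared across [X], [Y] and
    [endow m]. *)
Lemma discrete_metric_spaceP (R : realType) (X : metricType R) :
  discrete_metric_space X <->
  forall x : X, exists2 e : R, 0 < e & forall y, mdist x y < e -> y = x.
Proof.
rewrite /discrete_metric_space openE; split => [disc x|disc x _ ->].
  have /nbhs_ballP[e /= e0 xe] := disc x x erefl.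
  by exists e => // y xy; apply: xe; rewrite ballEmdist.
have [e e0 xe] := disc x; apply/nbhs_ballP; exists e => //= y.
by rewrite ballEmdist => /xe.
Qed.

Section ProductMetric.
Variables (R : realType) (X Y : metricType R) (m : metric_on R (X * Y)).
Hypothesis restrX :
  forall (x x' : X) (y : Y), dist_of m (x, y) (x', y) = mdist x x'.
Hypothesis restrY :
  forall (x : X) (y y' : Y), dist_of m (x, y) (x, y') = mdist y y'.
Hypothesis dist_ge_max : forall (x x' : X) (y y' : Y),
  Num.max (mdist x x') (mdist y y') <= dist_of m (x, y) (x', y').

Lemma dist_ge_fst p q : mdist p.1 q.1 <= dist_of m p q.
Proof.
case: p q => [x y] [x' y'].
by have := dist_ge_max x x' y y'; rewrite ge_max => /andP[].
Qed.

Lemma dist_ge_snd p q : mdist p.2 q.2 <= dist_of m p q.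
Proof.
case: p q => [x y] [x' y'].
by have := dist_ge_max x x' y y'; rewrite ge_max => /andP[].
Qed.

(** Go through the corner [(x', y)]: each leg lies in a fibre, where [m] is the metric of a
    factor. *)
Lemma dist_le_sum p q : dist_of m p q <= mdist p.1 q.1 + mdist p.2 q.2.
Proof.
case: p q => [x y] [x' y'] /=; rewrite -(restrX x x' y) -(restrY x' y y').
exact: (@metric_triangle _ (endow m)).
Qed.

Lemma discrete_product : discrete_metric_space X -> discrete_metric_space Y ->
  discrete_metric_space (endow m).
Proof.
move=> /discrete_metric_spaceP discX /discrete_metric_spaceP discY.
apply/discrete_metric_spaceP => p.
have [[e e0 pe] [d d0 pd]] := (discX p.1, discY p.2).
exists (Num.min e d) => [|q]; first by rewrite lt_min e0.
rewrite lt_min => /andP[pqe pqd].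
rewrite [LHS]surjective_pairing [RHS]surjective_pairing.
by rewrite (pe q.1 (le_lt_trans (dist_ge_fst p q) pqe))
           (pd q.2 (le_lt_trans (dist_ge_snd p q) pqd)).
Qed.

Lemma property_A_product : property_A X -> property_A Y ->
  property_A (endow m).
Proof.
move=> AX AY r eps r0 eps0.
(* As [e <= 1], the loss [e * (2 + e)] is at most [3 * e], hence at most [eps]. *)
pose e := Num.min 1 (eps / 3).
have e0 : 0 < e by rewrite lt_min ltr01 divr_gt0.
have e_eps : e * (2 + e) <= eps.
  have : e <= 1 by rewrite ge_min lexx.
  have : e <= eps / 3 by rewrite ge_min lexx orbT.
  by nra.
have [A [A0 ratioA [S AS]]] := AX r e r0 e0.
have [B [B0 ratioB [T BT]]] := AY r e r0 e0.
pose f (u : (X * nat) * (Y * nat)) : endow m * nat :=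
  ((u.1.1, u.2.1), choice.pickle (u.1.2, u.2.2)).
have f_inj : injective f.
  move=> [[x i] [y j]] [[x' i'] [y' j']] [-> ->].
  by move=> /(pcan_inj choice.pickleK)[-> ->].
exists (fun p => f @` (A p.1 `*` B p.2))%fset; split => [p|p q pq|].
- by rewrite -cardfs_gt0 card_imfsetM// muln_gt0 !cardfs_gt0 A0 B0.
(* Since [m] dominates both coordinate distances, points within [r] have coordinates within [r]. *)
- have [I0 ltA] := ratioA _ _ (le_trans (dist_ge_fst p q) pq).
  have [J0 ltB] := ratioB _ _ (le_trans (dist_ge_snd p q) pq).
  have [C0 ltC] := symdiff_ratio_imfsetM f_inj I0 J0 ltA ltB.
  by split=> //; exact: lt_le_trans ltC e_eps.
(* The coordinates move by at most [S] and [T], and [m] is at most the sum of the coordinate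
   distances. *)
- exists (S + T) => p q n /imfsetP[[[x i] [y j]]] /=.
  rewrite inE/= => /andP[xA yB] [-> _].
  apply: le_trans (dist_le_sum p (x, y)) _.
  by rewrite lerD//; [exact: AS xA | exact: BT yB].
Qed.

End ProductMetric.

Theorem corollary2p2p5 (R : realType) (X Y : metricType R)
  (discX : discrete_metric_space X) (discY : discrete_metric_space Y)
  (bgX : bounded_geometry X) (bgY : bounded_geometry Y)
  (AX : property_A X) (AY : property_A Y)
  (m : metric_on R (X * Y))
  (restrX : forall (x x' : X) (y : Y), dist_of m (x, y) (x', y) = mdist x x')
  (restrY : forall (x : X) (y y' : Y), dist_of m (x, y) (x, y') = mdist y y')
  (ge_max : forall (x x' : X) (y y' : Y),
     Num.max (mdist x x') (mdist y y') <= dist_of m (x, y) (x', y')) :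
  discrete_metric_space (endow m) /\ property_A (endow m).
Proof.
by split; [exact: discrete_product | exact: property_A_product].
Qed.
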